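(* Let $\mathcal{H}$ be a complex Hilbert space, let $d\geq 1$, and let $\mathbf{T}=(T_1,\ldots,T_d)\in\mathcal{B}(\mathcal{H})^d$ be a $d$-tuple of operators. Let $\widehat{\mathbf{T}}$ be the spherical Aluthge transform of $\mathbf{T}$. Then $$\omega(\mathbf{T})\leq\frac12\,\|\mathbf{T}\|+\frac12\,\omega(\widehat{\mathbf{T}}),$$ where $\omega(\cdot)$ and $\|\cdot\|$ denote the joint numerical radius and the joint operator norm of a $d$-tuple.
   Context: $\mathcal{B}(\mathcal{H})$ is the algebra of bounded linear operators on the complex Hilbert space $\mathcal{H}$ with inner product $\langle\cdot\mid\cdot\rangle$. The operators $T_k$ are not assumed to commute. For $\mathbf{T}=(T_1,\ldots,T_d)\in\mathcal{B}(\mathcal{H})^d$: the joint numerical radius is $\omega(\mathbf{T}):=\sup\{(\sum_{k=1}^d|\langle T_kx\mid x\rangle|^2)^{1/2}: x\in\mathcal{H},\ \|x\|=1\}$, and the joint operator norm is $\|\mathbf{T}\|:=\sup\{(\sum_{k=1}^d\|T_kx\|^2)^{1/2}: x\in\mathcal{H},\ \|x\|=1\}$. Polar decomposition of a tuple: regard $\mathbf{T}$ as the operator $S:\mathcal{H}\to\bigoplus_{i=1}^d\mathcal{H}$, $Sx=(T_1x,\ldots,T_dx)$. Let $S=VP$ be its (canonical) polar decomposition, so $P=(S^*S)^{1/2}=\sqrt{T_1^*T_1+\cdots+T_d^*T_d}$ is a positive operator on $\mathcal{H}$ and $V:\mathcal{H}\to\bigoplus_{i=1}^d\mathcal{H}$,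 $Vx=(V_1x,\ldots,V_dx)$, is the partial isometry with $\mathcal{N}(V)=\bigcap_{i}\mathcal{N}(V_i)=\mathcal{N}(P)=\bigcap_i\mathcal{N}(T_i)$. Thus $T_k=V_kP$ for $1\le k\le d$. Spherical Aluthge transform: $\widehat{\mathbf{T}}=(\widehat{T_1},\ldots,\widehat{T_d}):=(\sqrt{P}V_1\sqrt{P},\ldots,\sqrt{P}V_d\sqrt{P})$. *)

(* Defs.v *)
From HB Require Import structures.
From mathcomp Require Import all_boot all_order all_algebra.
From mathcomp Require Import all_classical all_reals all_analysis.
From mathcomp Require Import complex.

Set Implicit Arguments.
Unset Strict Implicit.
Unset Printing Implicit Defensive.

Import Order.TTheory GRing.Theory Num.Theory Num.Def.
Import numFieldNormedType.Exports.

Local Open Scope classical_set_scope.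
Local Open Scope ring_scope.

(* Scalars factor out of [inner] linearly on the left and conjugated on the
   right. *)
HB.mixin Record CompleteNormedModule_isHilbert (R : realType) H
    & CompleteNormedModule R[i] H := {
  inner : {dot H for conjC} ;
  innerE : forall x : H, inner x x = `|x| ^+ 2
}.

#[short(type="hilbertType")]
HB.structure Definition Hilbert (R : realType) :=
  {H of CompleteNormedModule R[i] H & CompleteNormedModule_isHilbert R H}.

(* The norms of H and of R[i] are valued in R[i]; this is the same norm as an
   element of R. *)
Definition rnorm (R : realType) (V : normedModType R[i]) (x : V) : R :=
  complex.Re `|x|.

Section Operators.
Variables (R : realType) (H : hilbertType R).
Implicit Types (A B P Q : H -> H) (x y : H).

Definition bounded_operator A : Prop :=
  linear A /\ exists M : R, forall x, rnorm (A x) <= M * rnorm x.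

Definition is_adjoint A B : Prop :=
  bounded_operator B /\ forall x y, inner (A x) y = inner x (B y).

Definition adjoint A : H -> H := xget (cst 0) [set B | is_adjoint A B].

(* The order of R[i] makes 0 <= z include that z is real. *)
Definition positive_operator A : Prop :=
  bounded_operator A /\ forall x, 0 <= inner (A x) x.

Definition is_sqrt_operator A Q : Prop := positive_operator Q /\ Q \o Q = A.

Definition sqrt_operator A : H -> H :=
  xget (cst 0) [set Q | is_sqrt_operator A Q].

Definition kernel A : set H := [set x | A x = 0].

Variable d : nat.
Implicit Types T V : 'I_d -> H -> H.

Definition joint_kernel T : set H := \bigcap_k kernel (T k).

Definition orthocomplement (E : set H) : set H :=
  [set x | forall y, E y -> inner x y = 0].

(* The column x |-> (V_1 x, .., V_d x), from H to the d-fold Hilbert sum of H,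
   is isometric on the orthogonal complement of its kernel. *)
Definition joint_partial_isometry V : Prop :=
  forall x, orthocomplement (joint_kernel V) x ->
    \sum_k rnorm (V k x) ^+ 2 = rnorm x ^+ 2.

Definition joint_modulus T : H -> H :=
  sqrt_operator (fun x => \sum_k adjoint (T k) (T k x)).

Definition is_polar_isometry T V : Prop :=
  [/\ forall k, bounded_operator (V k),
      joint_partial_isometry V,
      joint_kernel V = kernel (joint_modulus T)
    & forall k, T k = V k \o joint_modulus T].

Definition polar_isometry T : 'I_d -> H -> H :=
  xget (fun=> cst 0) [set V | is_polar_isometry T V].

Definition spherical_aluthge T : 'I_d -> H -> H :=
  let sqrtP := sqrt_operator (joint_modulus T) in
  fun k => sqrtP \o polar_isometry T k \o sqrtP.

(* On the zero space both suprema are over the empty set, and sup set0 = 0. *)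
Definition joint_numerical_radius T : R :=
  sup [set Num.sqrt (\sum_k complex.Re `|inner (T k x) x| ^+ 2)
      | x in [set x : H | rnorm x = 1]].

Definition joint_norm T : R :=
  sup [set Num.sqrt (\sum_k rnorm (T k x) ^+ 2)
      | x in [set x : H | rnorm x = 1]].

End Operators.

(* Main.v *)
Require Import Defs.
From mathcomp Require Import all_boot all_order all_algebra.
From mathcomp Require Import all_classical all_reals all_analysis.
From mathcomp Require Import complex ring lra.

Set Implicit Arguments.
Unset Strict Implicit.
Unset Printing Implicit Defensive.

Import Order.TTheory GRing.Theory Num.Theory Num.Def.
Import numFieldNormedType.Exports.

Local Open Scope classical_set_scope.
Local Open Scope ring_scope.
Local Open Scope complex_scope.

(** The polar decomposition turns the joint inequality into one about a single
    contraction. Let [P] be the joint modulus, [Q] its square root and [V] the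
    polar isometry. For a unit vector [x], choose a unit vector [l] of [C^d]
    with [(\sum_k |<T_k x, x>|^2)^(1/2) = \sum_k l_k <T_k x, x>]. With
    [U = \sum_k l_k V_k] this number is [Re <U P x, x>], and [U] is a
    contraction because the column [V] is one. If [U'] is the adjoint of [U],
    then polarisation of the positive form [<P u, v>] at [x] and [U' x] gives
      [4 Re <U P x, x> <= <P (1 + U') x, (1 + U') x> = |Q (1 + U') x|^2],
    and [Q (1 + U')] is bounded by the norm of its adjoint [(1 + U) Q]. Finally
      [|(1 + U) Q y|^2 = |Q y|^2 + |U Q y|^2 + 2 Re <Q U Q y, y>],
    where the first two terms are at most [|P| = |T|] for a unit vector [y],
    and [Q U Q] is the combination [\sum_k l_k \hat T_k], so that the last term
    is at most twice the joint numerical radius of the Aluthge transform. This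
    is [contraction_rinner_le].

    The adjoints, square roots and polar isometry have to be shown to exist.
    Representing functionals through an operator ([riesz_through]) gives adjoints,
    projections onto closures of ranges and the Douglas factorisation
    ([douglas_factor]), hence the polar isometry ([polar_isometry_exists]).
    Square roots come from the fixed point of [Y = (B + Y^2) / 2] for a
    self-adjoint contraction [B] ([sqrt_fixpoint]): then [(1 - Y)^2 = 1 - B].
    The operators under study are arbitrary choices among those with the
    defining properties, so the argument may use these properties only.

    Most of the work is done with the real inner product [Re <x, y>] and
    real-valued norms, where order reasoning is available. *)

(** * The real inner product *)

Section RealInner.
Context {R : realType} {H : hilbertType R}.
Implicit Types (x y z : H) (a : R[i]) (t : R) (A B S : H -> H).

Definition rinner x y : R := complex.Re (inner x y).

Lemma innerC x y : inner x y = (inner y x)^*.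
Proof.
have := hermC (@inner R H) x y.
by rewrite expr0 mul1r.
Qed.

Lemma rinnerC x y : rinner x y = rinner y x.
Proof. by rewrite /rinner innerC; case: (inner y x). Qed.

Lemma rinnerDl x y z : rinner (x + y) z = rinner x z + rinner y z.
Proof. by rewrite /rinner linearDl raddfD. Qed.

Lemma rinnerDr x y z : rinner z (x + y) = rinner z x + rinner z y.
Proof. by rewrite rinnerC rinnerDl !(rinnerC z). Qed.

Lemma innerDr x y z : inner z (x + y) = inner z x + inner z y.
Proof. by rewrite linearDr. Qed.

Lemma innerZl a x y : inner (a *: x) y = a * inner x y.
Proof. by rewrite linearZl_LR. Qed.

Lemma innerZr a x y : inner x (a *: y) = a^* * inner x y.
Proof. by rewrite linearZr_LR. Qed.

Lemma Re_realM t a : complex.Re (t%:C * a) = t * complex.Re a.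
Proof. by case: a => u v /=; rewrite mul0r subr0. Qed.

Lemma rinnerZl t x y : rinner (t%:C *: x) y = t * rinner x y.
Proof. by rewrite /rinner innerZl Re_realM. Qed.

Lemma rinnerZr t x y : rinner x (t%:C *: y) = t * rinner x y.
Proof. by rewrite rinnerC rinnerZl rinnerC. Qed.

Lemma rinnerNl x y : rinner (- x) y = - rinner x y.
Proof. by rewrite /rinner linearNl raddfN. Qed.

Lemma rinnerNr x y : rinner x (- y) = - rinner x y.
Proof. by rewrite rinnerC rinnerNl rinnerC. Qed.

Lemma rinnerBl x y z : rinner (x - y) z = rinner x z - rinner y z.
Proof. by rewrite rinnerDl rinnerNl. Qed.

Lemma rinnerBr x y z : rinner z (x - y) = rinner z x - rinner z y.
Proof. by rewrite rinnerDr rinnerNr. Qed.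

Lemma rinner0l x : rinner 0 x = 0.
Proof. by rewrite /rinner linear0l. Qed.

Lemma rinner0r x : rinner x 0 = 0.
Proof. by rewrite rinnerC rinner0l. Qed.

Lemma inner_suml (I : finType) (F : I -> H) y :
  inner (\sum_k F k) y = \sum_k inner (F k) y.
Proof. by rewrite linear_sumlz. Qed.

Lemma rinner_suml (I : finType) (F : I -> H) y :
  rinner (\sum_k F k) y = \sum_k rinner (F k) y.
Proof. by apply: (big_morph (rinner^~ y) _ (rinner0l y)) => u v; exact: rinnerDl. Qed.

Lemma rinnerii x y : rinner ('i *: x) ('i *: y) = rinner x y.
Proof.
by rewrite /rinner innerZl innerZr; case: (inner x y) => u v; simpc.
Qed.

Lemma Im_inner x y : complex.Im (inner x y) = rinner x ('i *: y).
Proof. by rewrite /rinner innerZr; case: (inner x y) => u v; simpc. Qed.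

Lemma rnormE (V : normedModType R[i]) (x : V) : `|x| = (rnorm x)%:C.
Proof. by rewrite /rnorm RRe_real // normr_real. Qed.

Lemma rnorm_ge0 (V : normedModType R[i]) (x : V) : 0 <= rnorm x.
Proof. by rewrite -ler0c -rnormE. Qed.

Lemma rinnerxx x : rinner x x = rnorm x ^+ 2.
Proof. by rewrite /rinner innerE rnormE -rmorphXn. Qed.

Lemma rnormZ (V : normedModType R[i]) t (x : V) :
  rnorm (t%:C *: x) = `|t| * rnorm x.
Proof.
by rewrite /rnorm normrZ normc_def /= expr0n addr0 sqrtr_sqr Re_realM.
Qed.

Lemma rnormN x : rnorm (- x) = rnorm x.
Proof. by rewrite /rnorm normrN. Qed.

Lemma rnormB x y : rnorm (x - y) = rnorm (y - x).
Proof. by rewrite /rnorm distrC. Qed.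

Lemma rnormD x y : rnorm (x + y) <= rnorm x + rnorm y.
Proof. by rewrite -lecR rmorphD /= -!rnormE ler_normD. Qed.

Lemma rnorm0 : rnorm (0 : H) = 0.
Proof. by rewrite /rnorm normr0. Qed.

Lemma rnorm_sum (I : finType) (F : I -> H) :
  rnorm (\sum_k F k) <= \sum_k rnorm (F k).
Proof.
apply: (big_ind2 (fun (u : H) t => rnorm u <= t)) => [|u t v r hu hv|k _] //.
  by rewrite rnorm0.
by rewrite (le_trans (rnormD _ _)) ?lerD.
Qed.

Lemma rnorm0_eq0 x : rnorm x = 0 -> x = 0.
Proof. by move=> x0; apply: normr0_eq0; rewrite rnormE x0. Qed.

Lemma rnorm_sqD x y :
  rnorm (x + y) ^+ 2 = rnorm x ^+ 2 + 2 * rinner x y + rnorm y ^+ 2.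
Proof. by rewrite -!rinnerxx !rinnerDl !rinnerDr (rinnerC y x); ring. Qed.

Lemma rnorm_sqB x y :
  rnorm (x - y) ^+ 2 = rnorm x ^+ 2 - 2 * rinner x y + rnorm y ^+ 2.
Proof. by rewrite rnorm_sqD rinnerNr rnormN; ring. Qed.

Lemma rinner_le x y : rinner x y <= rnorm x * rnorm y.
Proof.
have [x0|xn0] := eqVneq (rnorm x) 0; first by rewrite (rnorm0_eq0 x0) rinner0l rnorm0 mul0r.
have [y0|yn0] := eqVneq (rnorm y) 0; first by rewrite (rnorm0_eq0 y0) rinner0r rnorm0 mulr0.
have xp : 0 < rnorm x by rewrite lt0r xn0 rnorm_ge0.
have yp : 0 < rnorm y by rewrite lt0r yn0 rnorm_ge0.
have := sqr_ge0 (rnorm ((rnorm y)%:C *: x - (rnorm x)%:C *: y)).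
rewrite rnorm_sqB rinnerZl rinnerZr !rnormZ !ger0_norm ?rnorm_ge0 // => h.
have : 0 < rnorm x * rnorm y by rewrite mulr_gt0.
nra.
Qed.

Lemma rinner_abs_le x y : `|rinner x y| <= rnorm x * rnorm y.
Proof.
by rewrite ler_norml rinner_le andbT lerNl -rinnerNl -(rnormN x) rinner_le.
Qed.

Lemma rinner_eq0 x : (forall y, rinner x y = 0) -> x = 0.
Proof.
by move=> h; apply: rnorm0_eq0; apply/eqP; rewrite -sqrf_eq0 -rinnerxx h.
Qed.

Lemma rinner_inj x y : (forall z, rinner z x = rinner z y) -> x = y.
Proof.
by move=> h; apply/eqP; rewrite -subr_eq0; apply/eqP/rinner_eq0 => z; rewrite rinnerC rinnerBr h subrr.
Qed.

Lemma rnorm_cauchy_lim (u : nat -> H) :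
  (forall e : R, 0 < e -> exists N, forall m n, (N <= m)%N -> (N <= n)%N ->
     rnorm (u m - u n) < e) ->
  exists l, forall e : R, 0 < e -> exists N, forall n, (N <= n)%N ->
     rnorm (l - u n) < e.
Proof.
move=> hu.
have realpos (e : R[i]) : 0 < e -> exists2 e' : R, 0 < e' & e = e'%:C.
  by case: e => a b; rewrite ltcE /= => /andP[/eqP -> a0]; exists a.
have cu : cvg (u @ \oo).
  apply/cauchy_cvgP; apply: cauchy_exP => e /realpos[e' e0 ->].
  have [N hN] := hu _ e0.
  exists (u N); exists N => // n /= Nn.
  by rewrite -ball_normE /= rnormE ltcR hN.
exists (lim (u @ \oo)) => e e0.
have /cvgrPdist_lt/(_ e%:C) := cu.
rewrite ltcR => /(_ e0)[N _ hN].
by exists N => n Nn; have := hN n Nn; rewrite /= rnormE ltcR.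
Qed.

End RealInner.

(** * Representing functionals through an operator *)

Section Riesz.
Context {R : realType} {H : hilbertType R}.
Implicit Types (x y z : H) (t e : R) (A B S : H -> H).

Lemma linear_fD A : linear A -> {morph A : x y / x + y}.
Proof. by move=> lA x y; have := lA 1 x y; rewrite !scale1r. Qed.

Lemma linear_f0 A : linear A -> A 0 = 0.
Proof. by move=> lA; apply: (addIr (A 0)); rewrite -linear_fD // !add0r. Qed.

Lemma linear_fZ A : linear A -> forall a, {morph A : x / a *: x}.
Proof. by move=> lA a x; have := lA a x 0; rewrite (linear_f0 lA) !addr0. Qed.

Lemma linear_fN A : linear A -> {morph A : x / - x}.
Proof. by move=> lA x; rewrite -scaleN1r linear_fZ // scaleN1r. Qed.

Lemma linear_fB A : linear A -> {morph A : x y / x - y}.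
Proof. by move=> lA x y; rewrite linear_fD // linear_fN. Qed.

(** Carries identities between adjoints from the real inner product, where
    they are found, back to the complex one: rotating a vector by ['i] turns the
    real part of an inner product into the imaginary part. *)
Lemma rinner_inner A S B : linear A -> linear S ->
  (forall x y, rinner (A x) y = rinner (S x) (B y)) ->
  forall x y, inner (A x) y = inner (S x) (B y).
Proof.
move=> lA lS h x y.
apply/eqP; rewrite eq_complex; apply/andP; split; apply/eqP; first exact: h.
have rot u v : rinner u ('i *: v) = - rinner ('i *: u) v.
  by rewrite -[LHS]rinnerii scalerA -expr2 sqr_i scaleN1r rinnerNr.
by rewrite !Im_inner !rot -(linear_fZ lA) -(linear_fZ lS) h.
Qed.

Lemma le0_eps (X C : R) : 0 <= C -> (forall e, 0 < e -> X <= e * C) -> X <= 0.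
Proof.
move=> C0 h; rewrite leNgt; apply/negP => X0.
have C1 : 0 < C + 1 by lra.
have := h (X / (C + 1)); rewrite divr_gt0 // => /(_ isT).
rewrite mulrAC ler_pdivlMr //; nra.
Qed.

Lemma closure_rangeP S y :
  closure (range S) y <-> forall e, 0 < e -> exists z, rnorm (y - S z) < e.
Proof.
split=> [cy e e0|h B /nbhs_ballP[e /= e0 eB]].
  have e0C : (0 : R[i]) < e%:C by rewrite ltcR.
  have [_ [[z _ <-]]] := cy _ (nbhsx_ballx y _ e0C).
  by rewrite -ball_normE /= rnormE ltcR => ?; exists z.
have [e' e'0 eE] : exists2 e' : R, 0 < e' & e = e'%:C.
  by move: e0; case: e {eB} => a b; rewrite ltcE /= => /andP[/eqP -> a0]; exists a.
have [z hz] := h _ e'0; exists (S z); split; first by exists z.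
by apply: eB; rewrite -ball_normE /= rnormE eE ltcR.
Qed.

(** The Riesz representation theorem is the case [S = id]. A representer is the
    limit of the [S z] along a maximising sequence of [2 g z - |S z|^2]: the
    parallelogram identity makes the sequence [S z] Cauchy, and the first
    variation at the maximum gives the representation. *)
Lemma riesz_through S (g : H -> R) (M : R) : linear S ->
  (forall t x y, g (t%:C *: x + y) = t * g x + g y) ->
  (forall z, g z <= M * rnorm (S z)) ->
  exists2 y, closure (range S) y & forall z, g z = rinner (S z) y.
Proof.
move=> lS lg gM.
pose J z := 2 * g z - rnorm (S z) ^+ 2.
(* The expansion of [J] along a line gives both the parallelogram identity
   [para] and the first variation [hd]. *)
have var a w t : J (t%:C *: w + a) =
    J a + 2 * t * (g w - rinner (S a) (S w)) - t ^+ 2 * rnorm (S w) ^+ 2.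
  rewrite /J lg lS rnorm_sqD rnormZ exprMn real_normK ?num_real // rinnerZl.
  by rewrite (rinnerC (S w)); ring.
pose D := range J.
have ubD : has_ubound D.
  exists (M ^+ 2) => _ [z _ <-]; rewrite /J.
  have := gM z; have := sqr_ge0 (M - rnorm (S z)); nra.
have supD : has_sup D by split=> //; exists (J 0); exists 0.
have leD z : J z <= sup D by apply: ub_le_sup => //; exists z.
have near e : 0 < e -> exists z, sup D - e < J z.
  by move=> e0; have [_ [z _ <-] h] := sup_adherent e0 supD; exists z.
have /choice[z hz] : forall n : nat, exists z, sup D - n.+1%:R^-1 < J z.
  by move=> n; apply: near; rewrite invr_gt0.
have small e : 0 < e -> exists N, forall n, (N <= n)%N -> n.+1%:R^-1 < e.
  move=> e0; have [N _ hN] := near_infty_natSinv_lt (PosNum e0).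
  by exists N => n Nn; exact: hN.
have para a b : rnorm (S a - S b) ^+ 2 <= 4 * sup D - 2 * J a - 2 * J b.
  have := leD (2^-1%:C *: (b - a) + a); rewrite var.
  have -> : g (b - a) = g b - g a.
    by have := lg (-1) a b; rewrite rmorphN1 scaleN1r addrC => ->; ring.
  rewrite linear_fB // rinnerBr rinnerxx (rnormB (S b)) rnorm_sqB.
  have : 2 * g a = J a + rnorm (S a) ^+ 2 by rewrite /J; ring.
  have : 2 * g b = J b + rnorm (S b) ^+ 2 by rewrite /J; ring.
  lra.
have [l hl] : exists l, forall e : R, 0 < e -> exists N, forall n, (N <= n)%N ->
     rnorm (l - S (z n)) < e.
  apply: rnorm_cauchy_lim => e e0.
  have e2 : 0 < e ^+ 2 / 4 by rewrite divr_gt0 ?exprn_gt0.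
  have [N hN] := small _ e2.
  exists N => m n Nm Nn.
  rewrite -(@ltr_pXn2r _ 2) ?nnegrE ?rnorm_ge0 ?ltW //.
  have := para (z m) (z n); have := hN m Nm; have := hN n Nn.
  have := hz m; have := hz n.
  move: (n.+1%:R^-1) (m.+1%:R^-1) => q1 q2; lra.
exists l.
  by apply/closure_rangeP => e /hl[N /(_ N (leqnn N))]; exists (z N).
move=> w; set d := g w - rinner l (S w).
have hd t : 2 * t * d - t ^+ 2 * rnorm (S w) ^+ 2 <= 0.
  apply: (@le0_eps _ (1 + 2 * `|t| * rnorm (S w))) => [|e e0].
    by rewrite addr_ge0 // !mulr_ge0 // rnorm_ge0.
  have [N1 /(_ (maxn N1 _) (leq_maxl _ _)) h1] := small _ e0.
  have [N2 /(_ (maxn _ N2) (leq_maxr _ _)) h2] := hl _ e0.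
  move: (h1 N2) (h2 N1); set n := maxn N1 N2 => {}h1 {}h2.
  have := leD (t%:C *: w + z n); rewrite var.
  have := hz n; set q := n.+1%:R^-1 in h1 *.
  have -> : d = g w - rinner (S (z n)) (S w) - rinner (l - S (z n)) (S w).
    by rewrite /d rinnerBl; ring.
  have : `|t * rinner (l - S (z n)) (S w)| <= `|t| * (e * rnorm (S w)).
    rewrite normrM ler_wpM2l // (le_trans (rinner_abs_le _ _)) //.
    by rewrite ler_wpM2r ?rnorm_ge0 ?ltW.
  rewrite ler_norml => /andP[+ _].
  lra.
suff : d = 0 by move/eqP; rewrite subr_eq0 => /eqP ->; rewrite rinnerC.
set K := rnorm (S w) ^+ 2 in hd.
have K0 : 0 <= K by exact: sqr_ge0.
have K1 : 0 < K + 1 by lra.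
(* The best [t] would be [d / K], but [K] may vanish. *)
pose t := d / (K + 1).
have dE : d = t * (K + 1) by rewrite /t mulfVK // gt_eqF.
have := hd t; rewrite dE => h.
have : t ^+ 2 <= 0 by nra.
by rewrite real_exprn_even_le0 ?num_real //= => /eqP ->; rewrite mul0r.
Qed.

End Riesz.

(** * Bounded operators and their adjoints *)

Section Operators.
Context {R : realType} {H : hilbertType R}.
Implicit Types (x y z : H) (a : R[i]) (t e : R) (A B Q S : H -> H).

Lemma bounded_ge0 A : bounded_operator A ->
  exists2 M : R, 0 <= M & forall x, rnorm (A x) <= M * rnorm x.
Proof.
case=> _ [M hM]; exists `|M| => // x; apply: le_trans (hM x) _.
by rewrite ler_wpM2r ?rnorm_ge0 ?ler_norm.
Qed.

Lemma bounded_family (I : Type) (F : I -> H -> H) :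
  (forall k, bounded_operator (F k)) ->
  exists M : I -> R, forall k, 0 <= M k /\ forall x, rnorm (F k x) <= M k * rnorm x.
Proof.
move=> bF.
have /choice[M hM] : forall k, exists M : R, 0 <= M /\ forall x, rnorm (F k x) <= M * rnorm x.
  by move=> k; have [M] := bounded_ge0 (bF k); exists M.
by exists M.
Qed.

Lemma bounded_comp A B :
  bounded_operator A -> bounded_operator B -> bounded_operator (A \o B).
Proof.
move=> bA bB; split.
  by move=> a x y /=; rewrite bB.1 bA.1.
have [M M0 hM] := bounded_ge0 bA; have [N N0 hN] := bounded_ge0 bB.
exists (M * N) => x; apply: le_trans (hM _) _.
by rewrite -mulrA ler_wpM2l.
Qed.

Lemma rnormZC (V : normedModType R[i]) a (x : V) :
  rnorm (a *: x) = complex.Re `|a| * rnorm x.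
Proof. by rewrite /rnorm normrZ normc_def Re_realM. Qed.

Lemma bounded_scale a A :
  bounded_operator A -> bounded_operator (fun x => a *: A x).
Proof.
move=> bA; split.
  by move=> c x y; rewrite bA.1 !scalerDr !scalerA (mulrC a c).
have [M M0 hM] := bounded_ge0 bA; exists (complex.Re `|a| * M) => x.
rewrite rnormZC -mulrA ler_wpM2l //.
by rewrite normc_def sqrtr_ge0.
Qed.

Lemma bounded_sum (I : finType) (F : I -> H -> H) :
  (forall k, bounded_operator (F k)) ->
  bounded_operator (fun x => \sum_k F k x).
Proof.
move=> bF; split.
  by move=> a x y; rewrite scaler_sumr -big_split; apply: eq_bigr => k _; rewrite (bF k).1.
have [M hM] := bounded_family bF.
exists (\sum_k M k) => x; rewrite mulr_suml; apply: le_trans (rnorm_sum _) _.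
by apply: ler_sum => k _; case: (hM k).
Qed.

Lemma inner_inj x y : (forall z, inner z x = inner z y) -> x = y.
Proof. by move=> h; apply: rinner_inj => z; rewrite /rinner h. Qed.

Lemma adjoint_linear A B :
  (forall x y, inner (A x) y = inner x (B y)) -> linear B.
Proof.
move=> h a x y; apply: inner_inj => z.
by rewrite -h !innerDr !innerZr !h.
Qed.

Lemma adjoint_exists A : bounded_operator A -> exists B, is_adjoint A B.
Proof.
move=> bA; have lA := bA.1; have [M M0 hM] := bounded_ge0 bA.
have /choice[B hB] : forall y, exists w, forall z, rinner (A z) y = rinner z w.
  move=> y.
  have [|t x z|z|w _ hw] := @riesz_through R H idfun (fun z => rinner (A z) y) (M * rnorm y).
  - by [].
  - by rewrite lA rinnerDl rinnerZl.
  - rewrite (le_trans (rinner_le _ _)) // mulrAC ler_wpM2r ?rnorm_ge0 //.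
  - by exists w.
have h : forall x y, inner (A x) y = inner x (B y).
  by apply: (@rinner_inner _ _ A idfun) => // x y; rewrite hB.
exists B; split=> //; split; first exact: adjoint_linear h.
exists M => y.
have : rnorm (B y) ^+ 2 <= M * rnorm (B y) * rnorm y.
  rewrite -rinnerxx -hB (le_trans (rinner_le _ _)) // ler_wpM2r ?rnorm_ge0 //.
have := rnorm_ge0 (B y); rewrite le_eqVlt => /predU1P[<- _|B0].
  by rewrite mulr_ge0 // rnorm_ge0.
by rewrite expr2 -mulrA mulrCA ler_pM2l.
Qed.

Lemma adjointP A : bounded_operator A -> is_adjoint A (adjoint A).
Proof. by move=> /adjoint_exists[B hB]; apply: (xgetPex (cst 0)); exists B. Qed.

Lemma positive_rinner_ge0 A x : positive_operator A -> 0 <= rinner (A x) x.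
Proof. by case=> _ /(_ x); rewrite lecE => /andP[]. Qed.

(** This uses that the scalars are complex: [<A x, x>] is real for all [x], and
    the vanishing of its imaginary part at [x = u - i v] is the symmetry of [A]
    at [u] and [v]. *)
Lemma positive_symmetric A : positive_operator A ->
  forall x y, rinner (A x) y = rinner x (A y).
Proof.
case=> -[lA _] pA.
have im0 x : rinner (A x) ('i *: x) = 0.
  by rewrite -Im_inner; have := pA x; rewrite lecE => /andP[/eqP].
move=> u v; have := im0 (u - 'i *: v).
rewrite (linear_fB lA) (linear_fZ lA) scalerBr scalerA -expr2 sqr_i scaleN1r opprK.
rewrite rinnerDr !rinnerBl im0 rinnerii.
have -> : rinner ('i *: A v) v = 0.
  by rewrite -rinnerii scalerA -expr2 sqr_i scaleN1r rinnerNl im0 oppr0.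
rewrite (rinnerC u); lra.
Qed.

End Operators.

(** * Square roots of positive operators *)

Section SquareRoot.
Context {R : realType} {H : hilbertType R}.
Implicit Types (x y z : H) (t e : R) (A B Q : H -> H).

Lemma rnorm_small_eq x y (C : R) : 0 <= C ->
  (forall e : R, 0 < e -> rnorm (x - y) <= e * C) -> x = y.
Proof.
move=> C0 h; apply/eqP; rewrite -subr_eq0; apply/eqP/rnorm0_eq0/eqP.
by rewrite eq_le rnorm_ge0 (le0_eps C0 h).
Qed.

Lemma rnorm_triangle x y z : rnorm (x - z) <= rnorm (x - y) + rnorm (y - z).
Proof. by have := rnormD (x - y) (y - z); rewrite addrA subrK. Qed.

Section Iteration.
Context (B : H -> H) (lB : linear B).
Context (B1 : forall x, rnorm (B x) <= rnorm x).
Context (symB : forall x y, rinner (B x) y = rinner x (B y)).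

(** The iterates converge to the fixed point [Y] of [Y = (B + Y^2) / 2], for
    which [(1 - Y)^2 = 1 - B]. *)
Fixpoint sqrt_iter n : H -> H :=
  if n is n'.+1 then
    fun x => 2^-1%:C *: (B x + sqrt_iter n' (sqrt_iter n' x))
  else fun=> 0.

(** The same recursion with the contraction [B] replaced by its bound [1]. It
    increases in the interval from 0 to 1, so the steps of [sqrt_iter], which
    it dominates, are summable. *)
Fixpoint sqrt_majorant n : R :=
  if n is n'.+1 then 2^-1 * (1 + sqrt_majorant n' ^+ 2) else 0.

Local Notation Y := sqrt_iter.
Local Notation y := sqrt_majorant.

Lemma sqrt_majorant_bounds n : 0 <= y n <= 1.
Proof. by elim: n => [|n IH] /=; [lra|nra]. Qed.

Lemma sqrt_majorant_incr n : y n <= y n.+1.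
Proof. by have := sqr_ge0 (1 - y n) => /=; nra. Qed.

Lemma sqrt_majorant_mono m n : (m <= n)%N -> y m <= y n.
Proof.
move=> /subnK <-; elim: (n - m)%N => // k IH.
exact: le_trans IH (sqrt_majorant_incr _).
Qed.

Lemma linear_sqrt_iter n : linear (Y n).
Proof.
elim: n => [|n IH].
  by move=> a x z /=; rewrite scaler0 addr0.
move=> a x z /=.
by rewrite lB !IH addrACA !scalerDr !scalerA (mulrC a).
Qed.

Lemma rnorm_half x : rnorm (2^-1%:C *: x) = 2^-1 * rnorm x.
Proof. by rewrite rnormZ ger0_norm // invr_ge0. Qed.

Lemma sqrt_iter_le n x : rnorm (Y n x) <= y n * rnorm x.
Proof.
elim: n x => [|n IH] x /=; first by rewrite rnorm0 mul0r.
rewrite rnorm_half.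
have := IH x; have := IH (Y n x); have := rnormD (B x) (Y n (Y n x)).
have := B1 x; have := sqrt_majorant_bounds n; nra.
Qed.

Lemma sym_sqrt_iter n x z : rinner (Y n x) z = rinner x (Y n z).
Proof.
elim: n x z => [|n IH] x z /=; first by rewrite rinner0l rinner0r.
by rewrite rinnerZl rinnerZr rinnerDl rinnerDr symB !IH.
Qed.

(** The increments obey the recursion of the scalar increments, because of
    [Y' Y' - Y Y = Y' (Y' - Y) + (Y' - Y) Y] for consecutive iterates [Y] and
    [Y']. *)
Lemma sqrt_iter_step n x :
  rnorm (Y n.+1 x - Y n x) <= (y n.+1 - y n) * rnorm x.
Proof.
elim: n x => [|n IH] x.
  have := sqrt_iter_le 1 x; rewrite [Y 0 x]/= [y 0]/=.
  by rewrite !subr0.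
have -> : Y n.+2 x - Y n.+1 x = 2^-1%:C *:
    (Y n.+1 (Y n.+1 x - Y n x) + (Y n.+1 (Y n x) - Y n (Y n x))).
  rewrite (linear_fB (linear_sqrt_iter n.+1)).
  rewrite addrA subrK [Y n.+2]/= [in LHS](_ : Y n.+1 x = 2^-1%:C *: (B x + Y n (Y n x))) //.
  rewrite -scalerBr; congr (_ *: _).
  by rewrite opprD addrACA subrr add0r.
rewrite rnorm_half.
have := rnormD (Y n.+1 (Y n.+1 x - Y n x)) (Y n.+1 (Y n x) - Y n (Y n x)).
have := sqrt_iter_le n.+1 (Y n.+1 x - Y n x); have := IH (Y n x).
have := IH x; have := sqrt_iter_le n x.
have := sqrt_majorant_bounds n.+1; have := sqrt_majorant_incr n.
have -> : y n.+2 = 2^-1 * (1 + y n.+1 ^+ 2) by [].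
have -> : y n.+2 - y n.+1 = 2^-1 * (y n.+1 + y n) * (y n.+1 - y n) by rewrite /=; ring.
set a := rnorm (Y n.+1 x - Y n x); set b := rnorm (Y n.+1 (_ - _)).
set c := rnorm (_ - Y n (Y n x)); set q := rnorm (Y n x).
set w := rnorm (_ + _).
move: (y n.+1) (y n) => p r pr /andP[p0 p1] qr ap cp bp wbc.
have : p * a <= p * ((p - r) * rnorm x) by rewrite ler_wpM2l.
have : (p - r) * q <= (p - r) * (r * rnorm x) by rewrite ler_wpM2l // subr_ge0.
lra.
Qed.

Lemma sqrt_iter_diff m n x : (m <= n)%N ->
  rnorm (Y n x - Y m x) <= (y n - y m) * rnorm x.
Proof.
move=> /subnK <-; elim: (n - m)%N => [|k IH]; first by rewrite !subrr rnorm0 mul0r.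
rewrite addSn.
have := sqrt_iter_step (k + m) x.
have := rnormD (Y (k + m).+1 x - Y (k + m) x) (Y (k + m) x - Y m x).
rewrite addrA subrK; lra.
Qed.

Lemma sqrt_iter_limit : exists L : H -> H, forall e, 0 < e ->
  exists N, forall n x, (N <= n)%N -> rnorm (L x - Y n x) <= e * rnorm x.
Proof.
pose D := range y.
have supD : has_sup D.
  split; first by exists 0; exists 0.
  by exists 1 => _ [n _ <-]; case/andP: (sqrt_majorant_bounds n).
have ley n : y n <= sup D by apply: ub_le_sup; [exact: supD.2|exists n].
have near e : 0 < e -> exists N, sup D - e < y N.
  by move=> e0; have [_ [N _ <-] ?] := sup_adherent e0 supD; exists N.
have /choice[L hL] : forall x, exists l, forall e, 0 < e ->
    exists N, forall n, (N <= n)%N -> rnorm (l - Y n x) < e.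
  move=> x; apply: rnorm_cauchy_lim => e e0.
  have x1 : 0 < rnorm x + 1 by rewrite ltr_wpDl // rnorm_ge0.
  have [N hN] := near (e / 2 / (rnorm x + 1)) ltac:(by rewrite !divr_gt0).
  have dN n : (N <= n)%N -> rnorm (Y n x - Y N x) < e / 2.
    move=> Nn; apply: le_lt_trans (sqrt_iter_diff x Nn) _.
    have : e / 2 = e / 2 / (rnorm x + 1) * (rnorm x + 1).
      by rewrite mulfVK // gt_eqF.
    have := ley n; have := sqrt_majorant_mono Nn; have := rnorm_ge0 x.
    move: hN; set q := e / 2 / _ => hN rx yn yd ->.
    have q0 : 0 < q by rewrite !divr_gt0.
    nra.
  exists N => m n Nm Nn.
  have := rnormD (Y m x - Y N x) (Y N x - Y n x); rewrite addrA subrK.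
  rewrite (rnormB (Y N x)); have := dN _ Nm; have := dN _ Nn; lra.
exists L => e e0; have [N hN] := near _ e0; exists N => n x Nn.
rewrite -subr_le0; apply: (@le0_eps _ _ 1) => // f f0.
have [N' hN'] := hL x _ f0.
have := hN' (maxn N' n) (leq_maxl _ _).
have := sqrt_iter_diff x (leq_maxr N' n); set k := maxn _ _.
have := rnormD (L x - Y k x) (Y k x - Y n x); rewrite addrA subrK.
have := ley k; have := sqrt_majorant_mono Nn; have := rnorm_ge0 x.
nra.
Qed.

Lemma sqrt_fixpoint : exists L : H -> H,
  [/\ linear L, forall x, rnorm (L x) <= rnorm x,
      forall x z, rinner (L x) z = rinner x (L z)
    & forall x, 2%:C *: L x = B x + L (L x)].
Proof.
have [L hL] := sqrt_iter_limit.
have near e : 0 < e -> exists n, forall x,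
    rnorm (L x - Y n x) <= e * rnorm x /\ rnorm (L x - Y n.+1 x) <= e * rnorm x.
  move=> e0; have [N hN] := hL e e0; exists N => x.
  by split; apply: hN.
have Y1 n x : rnorm (Y n x) <= rnorm x.
  apply: le_trans (sqrt_iter_le n x) _.
  by rewrite ler_piMl ?rnorm_ge0 //; case/andP: (sqrt_majorant_bounds n).
have L1 x : rnorm (L x) <= rnorm x.
  rewrite -subr_le0; apply: (@le0_eps _ _ (rnorm x)); first exact: rnorm_ge0.
  move=> e /near[n /(_ x)[h _]].
  have := rnormD (L x - Y n x) (Y n x); rewrite subrK; have := Y1 n x; lra.
exists L; split=> //.
- move=> a x z.
  apply: (@rnorm_small_eq _ _
    (rnorm (a *: x + z) + complex.Re `|a| * rnorm x + rnorm z)).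
    by rewrite !addr_ge0 ?mulr_ge0 ?rnorm_ge0 // normc_def sqrtr_ge0.
  move=> e /near[n hn].
  have [ha _] := hn (a *: x + z); have [hx _] := hn x; have [hz _] := hn z.
  have := rnorm_triangle (L (a *: x + z)) (Y n (a *: x + z)) (a *: L x + L z).
  rewrite (rnormB (Y n _)) [in X in _ <= _ + X](linear_sqrt_iter n).
  have -> : a *: L x + L z - (a *: Y n x + Y n z) =
      a *: (L x - Y n x) + (L z - Y n z) by rewrite opprD addrACA scalerBr.
  have := rnormD (a *: (L x - Y n x)) (L z - Y n z).
  rewrite rnormZC.
  have : complex.Re `|a| * rnorm (L x - Y n x) <= complex.Re `|a| * (e * rnorm x).
    by rewrite ler_wpM2l // normc_def sqrtr_ge0.
  lra.
- move=> x z; apply/eqP; rewrite -subr_eq0 -normr_le0.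
  apply: (@le0_eps _ _ (2 * (rnorm x * rnorm z))).
    by rewrite !mulr_ge0 ?rnorm_ge0.
  move=> e /near[n hn].
  have -> : rinner (L x) z - rinner x (L z) =
      rinner (L x - Y n x) z - rinner x (L z - Y n z).
    by rewrite rinnerBl rinnerBr sym_sqrt_iter; ring.
  have := ler_normB (rinner (L x - Y n x) z) (rinner x (L z - Y n z)).
  have := rinner_abs_le (L x - Y n x) z; have := rinner_abs_le x (L z - Y n z).
  have [hx _] := hn x; have [hz _] := hn z.
  have := ler_wpM2r (rnorm_ge0 z) hx; have := ler_wpM2l (rnorm_ge0 x) hz; lra.
move=> x; apply: (@rnorm_small_eq _ _ (3 * rnorm x + rnorm (L x))).
  by rewrite addr_ge0 ?mulr_ge0 ?rnorm_ge0.
move=> e e0; have [n hn] := near _ e0.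
have -> : 2%:C *: L x - (B x + L (L x)) = 2%:C *: (L x - Y n.+1 x)
    - ((L (L x) - Y n (L x)) + Y n (L x - Y n x)).
  rewrite (linear_fB (linear_sqrt_iter n)) addrA subrK scalerBr [Y n.+1 x]/= scalerA.
  rewrite -rmorphM /= divff // scale1r -[RHS]addrA; congr (_ + _).
  by rewrite -opprD; congr (- _); rewrite -addrA; congr (_ + _); rewrite addrC subrK.
have := rnormD (2%:C *: (L x - Y n.+1 x)) (- (L (L x) - Y n (L x) + Y n (L x - Y n x))).
rewrite rnormN rnormZ ger0_norm //.
have := rnormD (L (L x) - Y n (L x)) (Y n (L x - Y n x)).
have := Y1 n (L x - Y n x); have [h1 h2] := hn x; have [h3 _] := hn (L x).
lra.
Qed.

End Iteration.

(** The positivity of [A] at the vector [x - A x / M]. This bound makes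
    [1 - A / M] a contraction. *)
Lemma positive_rnorm_sq A (M : R) x : positive_operator A -> 0 < M ->
  (forall y, rnorm (A y) <= M * rnorm y) ->
  rnorm (A x) ^+ 2 <= M * rinner (A x) x.
Proof.
move=> pA M0 hM; have lA := pA.1.1.
have := positive_rinner_ge0 (x - M^-1%:C *: A x) pA.
rewrite (linear_fB lA) (linear_fZ lA) !rinnerBl !rinnerBr !rinnerZl !rinnerZr.
rewrite (positive_symmetric pA (A x) x) rinnerxx.
have : rinner (A (A x)) (A x) <= M * rnorm (A x) ^+ 2.
  rewrite (le_trans (rinner_le _ _)) // expr2 mulrA ler_wpM2r ?rnorm_ge0 //.
set p := rinner (A x) x; set q := rinner (A (A x)) (A x); set s := rnorm _ ^+ 2.
move=> qs; have K : M * M^-1 = 1 by rewrite divff // gt_eqF.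
have M'0 : 0 < M^-1 by rewrite invr_gt0.
move: M'0 K; set c := M^-1 => c0 K h.
have cMs : c * (M * s) = s by rewrite mulrA (mulrC c) K mul1r.
have : c * (c * q) <= c * s by rewrite ler_pM2l // -cMs ler_pM2l.
have Mcs : M * (c * s) = s by rewrite mulrA K mul1r.
move=> hq; rewrite -Mcs ler_pM2l //.
move: h.
lra.
Qed.

(** Rescaling makes [B = 1 - A / N] a contraction; [Q] is [N^(1/2) (1 - L)] for
    the fixed point [L] of [L = (B + L^2) / 2], and it is positive because [L]
    is a self-adjoint contraction. *)
Lemma sqrt_operator_exists A : positive_operator A ->
  exists Q, is_sqrt_operator A Q.
Proof.
move=> pA; have [lA bA] := pA.1; have [M M0 hM] := bounded_ge0 pA.1.
pose N := M + 1; have N0 : 0 < N by rewrite ltr_wpDl.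
have hN x : rnorm (A x) <= N * rnorm x.
  by rewrite (le_trans (hM x)) // ler_wpM2r ?rnorm_ge0 // lerDl.
pose B x := x - N^-1%:C *: A x.
have lB : linear B.
  move=> a x z; rewrite /B lA !scalerDr scalerN !scalerA mulrC.
  by rewrite opprD addrACA.
have B1 x : rnorm (B x) <= rnorm x.
  rewrite -(@ler_pXn2r _ 2) ?nnegrE ?rnorm_ge0 // rnorm_sqB rinnerZr rnormZ.
  rewrite exprMn real_normK ?num_real // rinnerC.
  have := positive_rnorm_sq x pA N0 hN.
  have K : N * N^-1 = 1 by rewrite divff // gt_eqF.
  have N'0 : 0 < N^-1 by rewrite invr_gt0.
  move: N'0 K (sqr_ge0 (rnorm (A x))); set c := N^-1; set s := rnorm (A x) ^+ 2.
  set p := rinner _ _ => c0 K s0 h.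
  have : c ^+ 2 * s <= c ^+ 2 * (N * p) by rewrite ler_wpM2l // sqr_ge0.
  have -> : c ^+ 2 * (N * p) = c * p * (N * c) by ring.
  have := mulr_ge0 (sqr_ge0 c) s0.
  rewrite K; lra.
have symB x z : rinner (B x) z = rinner x (B z).
  by rewrite /B rinnerBl rinnerBr rinnerZl rinnerZr (positive_symmetric pA).
have [L [lL L1 symL fixL]] := sqrt_fixpoint lB B1 symB.
have [s s0 sE] : exists2 s : R, 0 <= s & s ^+ 2 = N.
  by exists (Num.sqrt N); rewrite ?sqrtr_ge0 ?sqr_sqrtr ?ltW.
pose Q x := s%:C *: (x - L x).
have lQ : linear Q.
  move=> a x z; rewrite /Q lL !scalerDr !scalerN scalerDr !scalerA opprD mulrC.
  by rewrite addrACA.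
have symQ x z : rinner (Q x) z = rinner x (Q z).
  by rewrite /Q rinnerZl rinnerZr rinnerBl rinnerBr symL.
exists Q; split.
  split.
    split=> //; exists (s * 2) => x; rewrite rnormZ ger0_norm // -mulrA ler_wpM2l //.
    have := rnormD x (- L x); rewrite rnormN; have := L1 x; lra.
  move=> x; rewrite lecE; apply/andP; split=> /=; last first.
    rewrite -/(rinner (Q x) x) rinnerZl mulr_ge0 // rinnerBl rinnerxx.
    rewrite subr_ge0 (le_trans (rinner_le _ _)) // expr2 ler_wpM2r ?rnorm_ge0 //.
  have lid : linear (@idfun H) by [].
  have := rinner_inner lQ lid symQ x x; rewrite [RHS]innerC.
  case: (inner (Q x) x) => a b [] /= hb.
  by apply/eqP; lra.
apply/funext => x /=; rewrite /Q.
rewrite (linear_fZ lL) (linear_fB lL) -scalerBr scalerA -rmorphM -expr2 sE.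
have -> : x - L x - (L x - L (L x)) = N^-1%:C *: A x.
  have -> : N^-1%:C *: A x = x - B x by rewrite /B opprB addrC subrK.
  have -> : B x = 2%:C *: L x - L (L x) by rewrite fixL addrK.
  rewrite rmorph_nat scaler_nat mulr2n.
  by rewrite -(addrA (L x)) (opprD (L x) (L x - L (L x))) addrA.
by rewrite scalerA -rmorphM divff ?gt_eqF // scale1r.
Qed.

Lemma sqrt_operatorP A : positive_operator A ->
  is_sqrt_operator A (sqrt_operator A).
Proof.
by move=> /sqrt_operator_exists[Q hQ]; apply: (xgetPex (cst 0)); exists Q.
Qed.

End SquareRoot.

(** * The polar decomposition of a tuple *)

Section Polar.
Context {R : realType} {H : hilbertType R}.
Implicit Types (x y z w : H) (a : R[i]) (t e : R) (A P Q S : H -> H).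

Lemma closure_range_orth S x y : closure (range S) y ->
  (forall z, rinner (S z) x = 0) -> rinner y x = 0.
Proof.
move=> /closure_rangeP cy ox; apply/eqP; rewrite -normr_le0.
apply: (@le0_eps _ _ (rnorm x)); first exact: rnorm_ge0.
move=> e /cy[z hz].
have -> : rinner y x = rinner (y - S z) x by rewrite rinnerBl ox subr0.
by rewrite (le_trans (rinner_abs_le _ _)) // ler_wpM2r ?rnorm_ge0 ?ltW.
Qed.

Lemma closure_range_eq0 S y : closure (range S) y ->
  (forall z, rinner (S z) y = 0) -> y = 0.
Proof.
move=> cy oy; apply: rnorm0_eq0; apply/eqP.
by rewrite -sqrf_eq0 -rinnerxx (closure_range_orth cy oy).
Qed.

Lemma closure_range_lin S a x y : linear S ->
  closure (range S) x -> closure (range S) y -> closure (range S) (a *: x + y).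
Proof.
move=> lS /closure_rangeP cx /closure_rangeP cy.
apply/closure_rangeP => e e0.
pose c := complex.Re `|a|; have c0 : 0 <= c by rewrite /c normc_def sqrtr_ge0.
have c1 : 0 < c + 1 by rewrite ltr_wpDl.
have [z hz] := cx (e / 2 / (c + 1)) ltac:(by rewrite !divr_gt0).
have [z' hz'] := cy (e / 2) ltac:(by rewrite divr_gt0).
exists (a *: z + z'); rewrite lS opprD addrACA -scalerBr.
have := rnormD (a *: (x - S z)) (y - S z'); rewrite rnormZC -/c.
have : c * rnorm (x - S z) <= e / 2.
  move: hz; rewrite ltr_pdivlMr // => /ltW; apply: le_trans.
  by rewrite mulrC ler_wpM2l ?rnorm_ge0 // lerDl.
lra.
Qed.

(** The projection [y] of [x] onto the closure of the range of [S] represents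
    [<S z, x>] through [S]. *)
Lemma range_projection S x : linear S ->
  exists2 y, closure (range S) y & forall z, rinner (S z) (x - y) = 0.
Proof.
move=> lS.
have [|t u v|z|y cy hy] := @riesz_through _ _ S (fun z => rinner (S z) x) (rnorm x).
- by [].
- by rewrite lS rinnerDl rinnerZl.
- by rewrite mulrC rinner_le.
- by exists y => // z; rewrite rinnerBr hy subrr.
Qed.

(** Douglas factorisation. The adjoint of the factor is easier to reach than
    the factor itself: it sends [w] to the vector that represents [<T z, w>]
    through [P]. *)
Lemma douglas_factor (T P : H -> H) (C : R) :
  bounded_operator T -> bounded_operator P -> 0 <= C ->
  (forall z, rnorm (T z) <= C * rnorm (P z)) ->
  exists V, [/\ bounded_operator V, T = V \o P
              & forall x, (forall z, rinner (P z) x = 0) -> V x = 0].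
Proof.
move=> bT bP C0 TP; have lT := bT.1; have lP := bP.1.
have /choice[W hW] : forall w, exists y, closure (range P) y /\
    forall z, rinner (T z) w = rinner (P z) y.
  move=> w.
  have [|t u v|z|y cy hy] :=
      @riesz_through _ _ P (fun z => rinner (T z) w) (C * rnorm w).
  - by [].
  - by rewrite lT rinnerDl rinnerZl.
  - by rewrite (le_trans (rinner_le _ _)) // mulrAC ler_wpM2r ?rnorm_ge0.
  - by exists y.
have iW z w : inner (T z) w = inner (P z) (W w).
  by apply: (rinner_inner lT lP) => {}z {}w; case: (hW w).
have lW : linear W.
  move=> a x y; apply/eqP; rewrite -subr_eq0; apply/eqP.
  have -> : W (a *: x + y) - (a *: W x + W y) =
      (-1) *: (a *: W x + W y) + W (a *: x + y) by rewrite scaleN1r addrC.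
  apply: (@closure_range_eq0 P) => [|z].
    have cW w : closure (range P) (W w) by case: (hW w).
    by apply: closure_range_lin => //; exact: closure_range_lin.
  rewrite rinnerDr scaleN1r rinnerNr /rinner -iW !innerDr !innerZr !iW.
  by rewrite addNr.
have bW : bounded_operator W.
  split=> //; exists C => w.
  have h : rnorm (W w) ^+ 2 <= C * rnorm (W w) * rnorm w.
    rewrite -subr_le0; apply: (@le0_eps _ _ (C * rnorm w + rnorm (W w))).
      by rewrite addr_ge0 ?mulr_ge0 ?rnorm_ge0.
    move=> e e0; have [/closure_rangeP/(_ e e0)[z hz] hw] := hW w.
    have -> : rnorm (W w) ^+ 2 = rinner (T z) w + rinner (W w - P z) (W w).
      by rewrite hw -rinnerDl addrC subrK rinnerxx.
    have := rinner_le (T z) w; have := rinner_le (W w - P z) (W w).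
    have := ler_wpM2r (rnorm_ge0 w) (TP z).
    have := ler_wpM2r (rnorm_ge0 (W w)) (ltW hz).
    have : rnorm (P z) <= rnorm (W w) + e.
      have := rnormD (W w) (P z - W w); rewrite addrC subrK (rnormB (P z)); lra.
    move=> /(ler_wpM2l C0)/(ler_wpM2r (rnorm_ge0 w)); lra.
  have := rnorm_ge0 (W w); rewrite le_eqVlt => /predU1P[<-|W0].
    by rewrite mulr_ge0 // rnorm_ge0.
  by move: h; rewrite expr2 mulrAC ler_pM2r.
have [V [bV hV]] := adjoint_exists bW.
have rV w x : rinner w (V x) = rinner (W w) x by rewrite /rinner hV.
exists V; split=> //.
  apply/funext => z; apply: rinner_inj => w.
  by rewrite /= rV rinnerC (hW w).2 rinnerC.
move=> x ox; apply: rinner_inj => w; rewrite rV rinner0r.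
exact: closure_range_orth (hW w).1 ox.
Qed.

Context {d : nat}.
Implicit Types T V : 'I_d -> H -> H.

Lemma joint_modulusP T : (forall k, bounded_operator (T k)) ->
  is_sqrt_operator (fun x => \sum_k adjoint (T k) (T k x)) (joint_modulus T).
Proof.
move=> bT; apply: sqrt_operatorP; split.
  apply: bounded_sum => k; apply: bounded_comp => //.
  by have [] := adjointP (bT k).
move=> x; rewrite inner_suml sumr_ge0 // => k _.
have [_ h] := adjointP (bT k).
by rewrite innerC -h conj_ge0 innerE exprn_ge0.
Qed.

Lemma joint_modulus_inner T : (forall k, bounded_operator (T k)) ->
  forall x y, rinner (joint_modulus T x) (joint_modulus T y) =
              \sum_k rinner (T k x) (T k y).
Proof.
move=> bT x y; have [pP PP] := joint_modulusP bT.
rewrite -(positive_symmetric pP) -[X in rinner X _]/((joint_modulus T \o joint_modulus T) x).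
rewrite PP rinner_suml; apply: eq_bigr => k _.
have [_ h] := adjointP (bT k).
by rewrite rinnerC [RHS]rinnerC /rinner -h.
Qed.

Lemma joint_modulus_norm T : (forall k, bounded_operator (T k)) ->
  forall x, rnorm (joint_modulus T x) ^+ 2 = \sum_k rnorm (T k x) ^+ 2.
Proof.
move=> bT x; rewrite -rinnerxx joint_modulus_inner //.
by apply: eq_bigr => k _; rewrite rinnerxx.
Qed.

(** The identity [\sum_k <V_k y, V_k y'> = <y, y'>] holds on the range of the
    modulus, and passes to the closure in one variable at a time. *)
Lemma polar_factor_isometry T V y : (forall k, bounded_operator (T k)) ->
  (forall k, bounded_operator (V k)) ->
  (forall k, T k = V k \o joint_modulus T) ->
  closure (range (joint_modulus T)) y ->
  \sum_k rnorm (V k y) ^+ 2 = rnorm y ^+ 2.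
Proof.
move=> bT bV TV cy; set P := joint_modulus T in TV cy *.
have VA k := adjointP (bV k).
(* [K] measures the failure of the column [V] to be isometric. *)
pose K x := \sum_k adjoint (V k) (V k x) - x.
have KE x z : rinner (K x) z = \sum_k rinner (V k x) (V k z) - rinner x z.
  rewrite rinnerBl rinner_suml; congr (_ - _); apply: eq_bigr => k _.
  by rewrite rinnerC [RHS]rinnerC /rinner (VA k).2.
have KC x z : rinner (K x) z = rinner (K z) x.
  rewrite !KE (rinnerC x); congr (_ - _).
  by apply: eq_bigr => k _; rewrite rinnerC.
have hP z z' : rinner (P z') (K (P z)) = 0.
  rewrite rinnerC KE joint_modulus_inner // -sumrB big1 // => k _.
  have E u : V k (P u) = T k u by rewrite (TV k).
  by rewrite !E subrr.
have hy z : rinner (P z) (K y) = 0.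
  by rewrite rinnerC KC rinnerC (closure_range_orth cy (hP z)).
have := closure_range_orth cy hy; rewrite rinnerC KE rinnerxx.
move=> /eqP; rewrite subr_eq0 => /eqP <-.
by apply: eq_bigr => k _; rewrite rinnerxx.
Qed.

(** Each [T_k] is dominated by the modulus [P], so the Douglas factorisation
    provides [V_k]. The closure of the range of [P], on which the column [V]
    is isometric, and the kernel of [P], on which it vanishes, are orthogonal
    complements; hence the kernel of [V] is that of [P]. *)
Lemma polar_isometry_exists T : (forall k, bounded_operator (T k)) ->
  exists V, is_polar_isometry T V.
Proof.
move=> bT; have [pP PP] := joint_modulusP bT.
set P := joint_modulus T in pP PP.
have bP := pP.1; have symP := positive_symmetric pP.
have /choice[V hV] : forall k, exists Vk, [/\ bounded_operator Vk, T k = Vk \o P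
              & forall x, (forall z, rinner (P z) x = 0) -> Vk x = 0].
  move=> k; apply: (@douglas_factor _ _ 1) => // z.
  rewrite mul1r -(@ler_pXn2r _ 2) ?nnegrE ?rnorm_ge0 // joint_modulus_norm //.
  by rewrite (bigD1 k) //= lerDl sumr_ge0 // => j _; rewrite sqr_ge0.
have bV k : bounded_operator (V k) by case: (hV k).
have TV k : T k = V k \o P by case: (hV k).
have V0 k x : (forall z, rinner (P z) x = 0) -> V k x = 0.
  by case: (hV k) => _ _; exact.
have isoV := polar_factor_isometry bT bV TV.
exists V; split=> //.
- move=> x ox; have [y cy oy] := range_projection x bP.1.
  have jy : joint_kernel V (x - y) by move=> k _; exact: V0.
  rewrite (_ : x = y); first exact: isoV.
  apply/eqP; rewrite -subr_eq0; apply/eqP/rnorm0_eq0/eqP.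
  rewrite -sqrf_eq0 -rinnerxx rinnerBl (closure_range_orth cy oy).
  by rewrite /rinner (ox _ jy) /= subr0.
- apply/seteqP; split => x /= kx; last first.
    have Px0 : P x = 0 by [].
    by move=> k _; apply: V0 => z; rewrite symP Px0 rinner0r.
  have [y cy oy] := range_projection x bP.1.
  have Pxy : P (x - y) = 0.
    by apply: rinner_inj => z; rewrite -symP oy rinner0r.
  suff y0 : y = 0 by rewrite -[x]subr0 -y0.
  apply: rnorm0_eq0; apply/eqP; rewrite -sqrf_eq0 -isoV // big1 // => k _.
  have -> : y = x - (x - y) by rewrite opprB addrC subrK.
  rewrite (linear_fB (bV k).1) (V0 k _ oy) subr0.
  by have -> : V k x = 0 by [exact: kx]; rewrite rnorm0 expr0n.
Qed.

Lemma polar_isometryP T : (forall k, bounded_operator (T k)) ->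
  is_polar_isometry T (polar_isometry T).
Proof.
move=> /polar_isometry_exists[V hV].
by apply: (xgetPex (fun=> cst 0)); exists V.
Qed.

(** Dropping the component of [x] in the kernel of the modulus decreases the
    norm of [x] and leaves [V_k x] unchanged. *)
Lemma polar_isometry_le T V x : (forall k, bounded_operator (T k)) ->
  is_polar_isometry T V -> \sum_k rnorm (V k x) ^+ 2 <= rnorm x ^+ 2.
Proof.
move=> bT [bV _ kerV TV]; have [pP _] := joint_modulusP bT.
have [y cy oy] := range_projection x pP.1.1.
have Pxy : joint_modulus T (x - y) = 0.
  apply: rinner_inj => z.
  by rewrite -(positive_symmetric pP) oy rinner0r.
have kxy : joint_kernel V (x - y) by rewrite kerV.
rewrite (eq_bigr (fun k => rnorm (V k y) ^+ 2)) => [|k _]; last first.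
  have Vxy : V k (x - y) = 0 by exact: kxy.
  move: Vxy; rewrite (linear_fB (bV k).1) => /eqP.
  by rewrite subr_eq0 => /eqP ->.
rewrite (polar_factor_isometry bT bV TV) //.
have := rnorm_sqD y (x - y); rewrite (closure_range_orth cy oy) addrC subrK => ->.
by rewrite mulr0 addr0 lerDl sqr_ge0.
Qed.

End Polar.

(** * The inequality *)

Section Inequality.
Context {R : realType} {H : hilbertType R}.
Implicit Types (x y z : H) (a : R[i]) (Q U A : H -> H).

Lemma modC_ge0 a : 0 <= complex.Re `|a|.
Proof. by rewrite normc_def sqrtr_ge0. Qed.

Lemma modC_sq a : complex.Re (a^* * a) = complex.Re `|a| ^+ 2.
Proof.
have := sqr_normc a; rewrite (mulrC a) => <-.
by rewrite normc_def -rmorphXn.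
Qed.

Lemma modCM a b : complex.Re `|a * b| = complex.Re `|a| * complex.Re `|b|.
Proof. by rewrite normrM normc_def Re_realM. Qed.

Lemma modC_ge_Re a : complex.Re a <= complex.Re `|a|.
Proof.
apply: le_trans (ler_norm _) _.
by have := normc_ge_Re a; rewrite lecE => /andP[].
Qed.

Lemma modC_inner_le x y : complex.Re `|inner x y| <= rnorm x * rnorm y.
Proof.
set a := inner x y.
have : complex.Re `|a| ^+ 2 <= complex.Re `|a| * (rnorm x * rnorm y).
  by rewrite -modC_sq -innerZl mulrA -normcJ -rnormZC; exact: rinner_le.
have := modC_ge0 a; rewrite le_eqVlt => /predU1P[<- _|a0].
  by rewrite mulr_ge0 ?rnorm_ge0.
by rewrite expr2 ler_pM2l.
Qed.

Lemma sum_le_sqrt (I : finType) (u v : I -> R) :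
  \sum_k u k ^+ 2 = 1 -> \sum_k u k * v k <= Num.sqrt (\sum_k v k ^+ 2).
Proof.
move=> u1; set S := \sum_k v k ^+ 2; set s := Num.sqrt S.
have S0 : 0 <= S by apply: sumr_ge0 => k _; exact: sqr_ge0.
have sS : s ^+ 2 = S by rewrite sqr_sqrtr.
have : 0 <= s by exact: sqrtr_ge0.
rewrite le_eqVlt => /predU1P[s0|s0].
  have /psumr_eq0P v0 : \sum_k v k ^+ 2 = 0 by rewrite -/S -sS -s0 expr0n.
  rewrite big1 ?s0 // => k _.
  have /eqP := v0 (fun k _ => sqr_ge0 (v k)) k isT.
  by rewrite sqrf_eq0 => /eqP ->; rewrite mulr0.
rewrite -(ler_pM2l s0) -expr2 sS mulr_sumr -subr_ge0.
suff : 0 <= \sum_k (s * u k - v k) ^+ 2.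
  have -> : \sum_k (s * u k - v k) ^+ 2 =
      s ^+ 2 * (\sum_k u k ^+ 2) - 2 * (\sum_k s * (u k * v k)) + S.
    rewrite !mulr_sumr -sumrB -big_split; apply: eq_bigr => k _ /=; ring.
  rewrite u1 sS; lra.
by apply: sumr_ge0 => k _; exact: sqr_ge0.
Qed.

(** With [U'] the adjoint of [U], polarisation gives
    [4 Re <U Q Q x, x> <= |Q (1 + U') x|^2]. The operator [Q (1 + U')] is
    bounded by the same constant as its adjoint [(1 + U) Q], and the
    hypotheses bound the square of the latter by [2 N + 2 W]. *)
Lemma contraction_rinner_le Q U (N W : R) x :
  positive_operator Q -> bounded_operator U ->
  (forall y, rnorm (U y) <= rnorm y) ->
  (forall y, rnorm (Q y) ^+ 2 <= N * rnorm y ^+ 2) ->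
  (forall y, rinner (Q (U (Q y))) y <= W * rnorm y ^+ 2) ->
  rinner (U (Q (Q x))) x <= (2^-1 * N + 2^-1 * W) * rnorm x ^+ 2.
Proof.
move=> pQ bU U1 hN hW; have symQ := positive_symmetric pQ; have lQ := pQ.1.1.
have [U' [_ hU']] := adjoint_exists bU.
have adjU u v : rinner (U u) v = rinner u (U' v) by rewrite /rinner hU'.
have h3 y : rnorm (Q y + U (Q y)) ^+ 2 <= 2 * (N + W) * rnorm y ^+ 2.
  rewrite rnorm_sqD symQ (rinnerC y).
  have := hN y; have := hW y.
  have : rnorm (U (Q y)) ^+ 2 <= rnorm (Q y) ^+ 2.
    by rewrite ler_pXn2r ?nnegrE ?rnorm_ge0.
  lra.
pose y := Q (x + U' x).
have h1 : 4 * rinner (U (Q (Q x))) x <= rnorm y ^+ 2.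
  rewrite /y (linear_fD lQ) rnorm_sqD adjU symQ.
  have := sqr_ge0 (rnorm (Q x - Q (U' x))); rewrite rnorm_sqB; lra.
have h2 : rnorm y ^+ 2 <= rnorm (Q y + U (Q y)) * rnorm x.
  rewrite -rinnerxx {2}/y -symQ rinnerDr -adjU -rinnerDl.
  exact: rinner_le.
have h4 : (rnorm y ^+ 2) ^+ 2 <= 2 * (N + W) * rnorm x ^+ 2 * rnorm y ^+ 2.
  have : (rnorm y ^+ 2) ^+ 2 <= (rnorm (Q y + U (Q y)) * rnorm x) ^+ 2.
    by rewrite ler_pXn2r ?nnegrE ?mulr_ge0 ?rnorm_ge0 ?sqr_ge0.
  have := ler_wpM2r (sqr_ge0 (rnorm x)) (h3 y).
  rewrite exprMn; lra.
have h5 : 0 <= 2 * (N + W) * rnorm x ^+ 2 by apply: le_trans (h3 x); exact: sqr_ge0.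
suff : rnorm y ^+ 2 <= 2 * (N + W) * rnorm x ^+ 2 by lra.
have := sqr_ge0 (rnorm y); rewrite le_eqVlt => /predU1P[<- //|y0].
by move: h4; rewrite expr2 ler_pM2r.
Qed.

Lemma sup_ge0 (E : set R) : (forall t, E t -> 0 <= t) -> 0 <= sup E.
Proof.
move=> E0; have [supE|] := pselect (has_sup E); last by move=> /sup_out ->.
by have [[t Et] ubE] := supE; apply: le_trans (E0 t Et) (ub_le_sup ubE Et).
Qed.

Context {d : nat}.
Implicit Types T V : 'I_d -> H -> H.

Lemma joint_numerical_radius_ge0 T : 0 <= joint_numerical_radius T.
Proof. by apply: sup_ge0 => _ [x _ <-]; exact: sqrtr_ge0. Qed.

Lemma joint_norm_ge0 T : 0 <= joint_norm T.
Proof. by apply: sup_ge0 => _ [x _ <-]; exact: sqrtr_ge0. Qed.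

Lemma rnorm_normalize x : x != 0 -> exists2 u, rnorm u = 1 & x = (rnorm x)%:C *: u.
Proof.
move=> x0; have r0 : rnorm x != 0 by apply: contraNN x0 => /eqP/rnorm0_eq0 ->.
exists ((rnorm x)^-1%:C *: x).
  by rewrite rnormZ ger0_norm ?invr_ge0 ?rnorm_ge0 // mulVf.
by rewrite scalerA -rmorphM divff // scale1r.
Qed.

(** Homogeneity extends the bounds by the suprema from unit vectors to all
    vectors. *)
Lemma joint_norm_le T x : (forall k, bounded_operator (T k)) ->
  Num.sqrt (\sum_k rnorm (T k x) ^+ 2) <= joint_norm T * rnorm x.
Proof.
move=> bT; have [->|/rnorm_normalize[u u1 ->]] := eqVneq x 0.
  rewrite rnorm0 mulr0 big1 ?sqrtr0 // => k _.
  by rewrite (linear_f0 (bT k).1) rnorm0 expr0n.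
have r0 := rnorm_ge0 x; set r := rnorm x in r0 *.
rewrite rnormZ u1 mulr1 ger0_norm //.
rewrite (eq_bigr (fun k => r ^+ 2 * rnorm (T k u) ^+ 2)) => [|k _]; last first.
  by rewrite (linear_fZ (bT k).1) rnormZ ger0_norm // exprMn.
rewrite -mulr_sumr sqrtrM ?sqr_ge0 // sqrtr_sqr ger0_norm // mulrC.
rewrite ler_wpM2r //; apply: ub_le_sup; last by exists u.
have [M hM] := bounded_family bT.
exists (Num.sqrt (\sum_k M k ^+ 2)) => _ [v /= v1 <-].
apply: ler_wsqrtr; apply: ler_sum => k _; have [Mk hk] := hM k.
by rewrite ler_pXn2r ?nnegrE ?rnorm_ge0 // (le_trans (hk v)) // v1 mulr1.
Qed.

Lemma joint_numerical_radius_le T x : (forall k, bounded_operator (T k)) ->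
  Num.sqrt (\sum_k complex.Re `|inner (T k x) x| ^+ 2) <=
  joint_numerical_radius T * rnorm x ^+ 2.
Proof.
move=> bT; have [->|/rnorm_normalize[u u1 ->]] := eqVneq x 0.
  rewrite rnorm0 expr0n mulr0 big1 ?sqrtr0 // => k _.
  have := modC_inner_le (T k 0) 0; rewrite rnorm0 mulr0 => h.
  have -> : complex.Re `|inner (T k 0) 0| = 0 by apply/eqP; rewrite eq_le h modC_ge0.
  by rewrite expr0n.
have r0 := rnorm_ge0 x; set r := rnorm x in r0 *.
rewrite rnormZ u1 mulr1 ger0_norm //.
rewrite (eq_bigr (fun k => (r ^+ 2) ^+ 2 * complex.Re `|inner (T k u) u| ^+ 2)); last first.
  move=> k _; rewrite (linear_fZ (bT k).1) innerZl innerZr.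
  rewrite [conjC _]conjc_real mulrA -rmorphM.
  by rewrite modCM normc_def /= expr0n addr0 sqrtr_sqr ger0_norm ?mulr_ge0 // -expr2 exprMn.
rewrite -mulr_sumr sqrtrM ?sqr_ge0 // sqrtr_sqr ger0_norm ?sqr_ge0 // mulrC.
rewrite ler_wpM2r ?sqr_ge0 //; apply: ub_le_sup; last by exists u.
have [M hM] := bounded_family bT.
exists (Num.sqrt (\sum_k M k ^+ 2)) => _ [v /= v1 <-].
apply: ler_wsqrtr; apply: ler_sum => k _; have [Mk hk] := hM k.
rewrite ler_pXn2r ?nnegrE ?modC_ge0 // (le_trans (modC_inner_le _ _)) //.
by rewrite v1 mulr1 (le_trans (hk v)) // v1 mulr1.
Qed.

End Inequality.

Theorem theorem3p1 (R : realType) (H : hilbertType R) (d : nat)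
    (hd : (1 <= d)%N) (T : 'I_d -> H -> H)
    (hT : forall k : 'I_d, bounded_operator (T k)) :
  joint_numerical_radius T <=
    2^-1 * joint_norm T + 2^-1 * joint_numerical_radius (spherical_aluthge T).
Proof.
have [pP _] := joint_modulusP hT.
have polV := polar_isometryP hT; have [bV _ _ TV] := polV.
have [pQ QQ] := sqrt_operatorP pP.
set P := joint_modulus T in pP TV pQ QQ.
set Q := sqrt_operator P in pQ QQ; set V := polar_isometry T in polV bV TV.
set N := joint_norm T; set W := joint_numerical_radius (spherical_aluthge T).
have bhat k : bounded_operator (spherical_aluthge T k).
  by apply: bounded_comp; [apply: bounded_comp|]; [exact: pQ.1| |exact: pQ.1].
have rhs0 : 0 <= 2^-1 * N + 2^-1 * W.
  by rewrite addr_ge0 // mulr_ge0 ?joint_norm_ge0 ?joint_numerical_radius_ge0.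
rewrite {1}/joint_numerical_radius; set E := image _ _.
have [[t Et]|E0] := pselect (E !=set0); last first.
  (* On the zero space the supremum is over the empty set. *)
  have -> : E = set0 by rewrite -subset0 => t Et; case: E0; exists t.
  by rewrite sup0.
apply: ge_sup; first by exists t.
move=> {t Et} _ [x /= x1 <-].
set s := Num.sqrt _.
have : (0 == s) || (0 < s) by rewrite -le_eqVlt sqrtr_ge0.
move=> /predU1P[<- //|s0].
(* The unit vector of [C^d] at which the linear form with coefficients
   [<T_k x, x>] attains its norm [s]. *)
pose l k : R[i] := s^-1%:C * (inner (T k x) x)^*.
have l1 : \sum_k complex.Re `|l k| ^+ 2 = 1.
  rewrite (eq_bigr (fun k => s ^- 2 * complex.Re `|inner (T k x) x| ^+ 2)).
    rewrite -mulr_sumr -[X in _ * X]sqr_sqrtr ?mulVf //.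
      by rewrite expf_eq0 /= gt_eqF.
    by apply: sumr_ge0 => k _; exact: sqr_ge0.
  move=> k _; rewrite modCM normcJ exprMn normc_def /= expr0n addr0 sqrtr_sqr.
  by rewrite ger0_norm ?invr_ge0 ?ltW // exprVn.
pose U y := \sum_k l k *: V k y.
have bU : bounded_operator U.
  by apply: bounded_sum => k; exact: bounded_scale.
have U1 y : rnorm (U y) <= rnorm y.
  apply: le_trans (rnorm_sum _) _.
  rewrite (eq_bigr (fun k => complex.Re `|l k| * rnorm (V k y))) => [|k _]; last first.
    exact: rnormZC.
  apply: le_trans (sum_le_sqrt _ l1) _.
  rewrite -[leRHS]ger0_norm ?rnorm_ge0 // -sqrtr_sqr; apply: ler_wsqrtr.
  exact: polar_isometry_le.
have hN y : rnorm (Q y) ^+ 2 <= N * rnorm y ^+ 2.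
  rewrite -rinnerxx -(positive_symmetric pQ) -[Q (Q y)]/((Q \o Q) y) QQ.
  rewrite (le_trans (rinner_le _ _)) // expr2 mulrA ler_wpM2r ?rnorm_ge0 //.
  rewrite -[leLHS]ger0_norm ?rnorm_ge0 // -sqrtr_sqr joint_modulus_norm //.
  exact: joint_norm_le.
have hW y : rinner (Q (U (Q y))) y <= W * rnorm y ^+ 2.
  apply: le_trans (joint_numerical_radius_le y bhat).
  apply: le_trans (sum_le_sqrt _ l1).
  rewrite (positive_symmetric pQ) rinner_suml; apply: ler_sum => k _.
  rewrite -modCM (le_trans _ (modC_ge_Re _)) // -innerZl.
  rewrite -[complex.Re _]/(rinner _ _) /spherical_aluthge /= -(linear_fZ pQ.1.1).
  by rewrite (positive_symmetric pQ).
have := contraction_rinner_le x pQ bU U1 hN hW; rewrite x1 expr1n mulr1.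
apply: le_trans.
rewrite rinner_suml (eq_bigr (fun k => s^-1 * complex.Re `|inner (T k x) x| ^+ 2)).
  rewrite -mulr_sumr -[X in _ * X]sqr_sqrtr; last first.
    by apply: sumr_ge0 => k _; exact: sqr_ge0.
  by rewrite -/s expr2 mulrA mulVf ?gt_eqF // mul1r.
move=> k _; rewrite -[Q (Q x)]/((Q \o Q) x) QQ -[V k (P x)]/((V k \o P) x) -TV.
by rewrite /rinner innerZl -mulrA Re_realM modC_sq.
Qed.
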